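(* Let $n,\lambda,\mu,\nu$ be nonnegative integers with $\lambda>1+\mu+\nu$. Then \[\sum_{k=0}^n \frac{\binom{n}{k}\binom{\lambda n+k}{k}\binom{\mu n+n}{k}}{\binom{\nu n+k}{k}\binom{(\lambda-\mu-\nu-2)n+k}{k}}\Big\{H_{\nu n+k}-H_{(\lambda-\mu-\nu-2)n+k}\Big\} = \frac{\binom{(\lambda-\nu)n}{n}\binom{(\mu+\nu+2)n}{n}}{\binom{\nu n+n}{n}\binom{(\lambda-\mu-\nu-1)n}{n}}\Big\{H_{(\mu+\nu+1)n}-H_{(\mu+\nu+2)n}+H_{(\lambda-\nu)n}-H_{(\lambda-\nu-1)n}+H_{\nu n+n}-H_{(\lambda-\mu-\nu-1)n}\Big\}.\]
   Context: $H_0=0$ and $H_m=\sum_{j=1}^m \frac{1}{j}$ for positive integers $m$ (classical harmonic numbers). *)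

(* Defs.v *)
From mathcomp Require Import all_boot all_order all_algebra.

Set Implicit Arguments.
Unset Strict Implicit.
Unset Printing Implicit Defensive.

Import GRing.Theory.
Local Open Scope ring_scope.

Definition harmonic (m : nat) : rat := \sum_(1 <= j < m.+1) j%:R^-1.

(* Main.v *)
Require Import Defs.
From mathcomp Require Import all_boot all_order all_algebra.
From mathcomp Require Import ring zify.

Set Implicit Arguments.
Unset Strict Implicit.
Unset Printing Implicit Defensive.

Import GRing.Theory.
Local Open Scope ring_scope.

(** With [p = nu n], [q = (lam - mu - nu - 2) n] and [M = (mu + 1) n], the
    summands are, up to a factor independent of [k], those of the
    Pfaff-Saalschuetz sum cleared of denominators,
      [sum_k C(n,k) (a)_k M^_k (P+k)_(n-k) (Q+k)_(n-k) = (P+M)_n (Q+M)_n],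
    where [a + 1 = P + Q + M + n].  This identity holds in every commutative
    ring.  Taking [P = p + 1 - X] and [Q = q + 1 + X] in [rat[X]] keeps [a]
    constant, and comparing the derivatives at [X = 0] brings in the harmonic
    numbers. *)

Definition rising (R : comNzRingType) (x : R) (k : nat) : R :=
  \prod_(0 <= i < k) (x + i%:R).

Section Rising.
Variable R : comNzRingType.
Implicit Types x a P Q : R.

Lemma rising0 x : rising x 0 = 1.
Proof. by rewrite /rising big_geq. Qed.

Lemma risingSr x k : rising x k.+1 = rising x k * (x + k%:R).
Proof. by rewrite /rising big_nat_recr. Qed.

Lemma risingSl x k : rising x k.+1 = x * rising (x + 1) k.
Proof.
rewrite /rising big_nat_recl //= addr0; congr (_ * _).
by apply: eq_bigr => i _; rewrite -addrA -natr1 [1 + _]addrC.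
Qed.

Lemma natr_ffactSr M k :
  (M ^_ k.+1)%:R = (M ^_ k)%:R * (M%:R - k%:R) :> R.
Proof.
rewrite ffactnSr natrM; have [leM|ltM] := leqP k M; first by rewrite natrB.
(* For [k > M] the subtraction in nat truncates, but [M ^_ k] already vanishes. *)
by rewrite ffact_small // !mul0r.
Qed.

(* Gosper-summed form of the recurrence in [n] behind Pfaff-Saalschuetz; the
   last product is the certificate. *)
Lemma saalschutz_partial_sum a P Q (n M m : nat) :
    a = P + Q + M%:R + n%:R -> (m <= n)%N ->
  \sum_(0 <= k < m.+1) 'C(n.+1, k)%:R * (rising a k * (M ^_ k)%:R)
     * (rising (P + k%:R) (n.+1 - k) * rising (Q + k%:R) (n.+1 - k))
  = (P + M%:R) * (Q + M%:R + n%:R) *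
    (\sum_(0 <= k < m.+1) 'C(n, k)%:R * (rising a k * (M ^_ k)%:R)
       * (rising (P + 1 + k%:R) (n - k) * rising (Q + k%:R) (n - k)))
    - 'C(n, m)%:R * (rising a m.+1 * (M ^_ m.+1)%:R)
       * (rising (P + 1 + m%:R) (n - m) * rising (Q + m%:R) (n - m)).
Proof.
move=> def_a; elim: m => [_|m IHm lt_mn].
  rewrite !big_nat1 !bin0 !subn0 !addr0 risingSl (risingSr Q) (risingSr a).
  by rewrite natr_ffactSr rising0 ffactn0 def_a; ring.
rewrite big_nat_recr //= IHm ?(ltnW lt_mn) // [in RHS]big_nat_recr //=.
rewrite subSS -(subnSK lt_mn); move: (n - m.+1)%N (subnKC lt_mn) => d def_n.
have bin_mn : m.+1%:R * 'C(n, m.+1)%:R = d.+1%:R * 'C(n, m)%:R :> R.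
  by rewrite -!natrM mul_bin_left -def_n addSnnS addKn.
rewrite binS natrD (risingSr a m.+1) (natr_ffactSr M m.+1).
(* Peeling one factor off each longer product leaves the products of length [d] starting at
   [P + m + 2] and [Q + m + 1] common to all terms. *)
rewrite (risingSl (P + 1 + m%:R)) (risingSl (P + m.+1%:R)).
rewrite (risingSl (Q + m%:R)) (risingSr (Q + m.+1%:R)).
have -> : Q + m%:R + 1 = Q + m.+1%:R by rewrite -addrA natr1.
have -> : P + 1 + m%:R = P + m.+1%:R by rewrite -addrA nat1r.
have -> : P + 1 + m.+1%:R = P + m.+1%:R + 1 by rewrite addrAC.
move: (rising (Q + _) d) (rising (P + _ + 1) d) (rising a _) (M ^_ _)%:R.
move=> rQ rP ra rM.
have nE : n%:R = m%:R + 1 + d%:R :> R by rewrite -def_n natrD natr1.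
rewrite def_a nE -!natr1 in bin_mn *.
set S := \sum_(0 <= _ < _) _; move: S => S.
move: 'C(n, m.+1)%:R 'C(n, m)%:R bin_mn => C1 C0 bin_mn.
apply/eqP; rewrite -subr_eq0; apply/eqP.
(* The two sides differ by a multiple of the binomial relation [bin_mn]. *)
transitivity (((d%:R + 1) * C0 - (m%:R + 1) * C1)
  * (ra * rM * rP * rQ * (P + m%:R + 1))); first by ring.
by rewrite bin_mn subrr mul0r.
Qed.

(** Induction on [n] with [P] varying: at [m = n] the certificate cancels the term [k = n + 1], and
    the remaining sum is the case [n] at [P + 1], with the same [a]. *)
Lemma pfaff_saalschutz a P Q (n M : nat) :
    a + 1 = P + Q + M%:R + n%:R ->
  \sum_(0 <= k < n.+1) 'C(n, k)%:R * (rising a k * (M ^_ k)%:R)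
     * (rising (P + k%:R) (n - k) * rising (Q + k%:R) (n - k))
  = rising (P + M%:R) n * rising (Q + M%:R) n.
Proof.
elim: n P => [|n IHn] P def_a.
  by rewrite big_nat1 !rising0 bin0 ffactn0 !mulr1.
have {}def_a : a = P + Q + M%:R + n%:R.
  by apply: (addIr 1); rewrite def_a -natr1 addrA.
rewrite big_nat_recr //= (saalschutz_partial_sum def_a) // IHn; last first.
  by rewrite def_a; ring.
rewrite !subnn !rising0 !binn (risingSl (P + _)) (risingSr (Q + _)).
by rewrite (addrAC P 1); ring.
Qed.

End Rising.

Lemma rising_natE (c m : nat) :
  rising (c.+1%:R : rat) m = (c + m)`!%:R / c`!%:R.
Proof.
have cf_neq0 k : k`!%:R != 0 :> rat by rewrite Num.Theory.pnatr_eq0 -lt0n fact_gt0.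
elim: m => [|m IHm]; first by rewrite rising0 addn0 divff.
rewrite risingSr IHm addnS factS natrM -natrD addSn mulrAC.
by rewrite [_ * _%:R]mulrC.
Qed.

Lemma harmonicS m : harmonic m.+1 = harmonic m + m.+1%:R^-1.
Proof. by rewrite /harmonic big_nat_recr. Qed.

Lemma horner_rising (c e : rat) m :
  (rising (c%:P + e *: 'X) m).[0] = rising c m.
Proof.
elim: m => [|m IHm]; first by rewrite !rising0 hornerC.
by rewrite !risingSr hornerM IHm -polyC_natr !hornerE ?mulr0 ?addr0.
Qed.

(** Logarithmic derivative: the factor [c + 1 + i + e X] contributes [e / (c + 1 + i)] at 0, and
    these sum to a difference of harmonic numbers. *)
Lemma horner_deriv_rising (c m : nat) (e : rat) :
  (rising (c.+1%:R%:P + e *: 'X) m)^`().[0]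
  = rising c.+1%:R m * (e * (harmonic (c + m) - harmonic c)).
Proof.
elim: m => [|m IHm].
  by rewrite rising0 derivC hornerC addn0 subrr !mulr0.
rewrite !risingSr derivM hornerD !hornerM IHm horner_rising.
rewrite -polyC_natr !derivD !derivC derivZ derivX !hornerE addnS harmonicS.
rewrite -natrD addSn.
have : (c + m).+1%:R != 0 :> rat by rewrite Num.Theory.pnatr_eq0.
by move: (c + m).+1%:R => y y_neq0 /=; field.
Qed.

Section HarmonicSaalschutz.
Variables p q M n : nat.

(** The Pfaff-Saalschuetz summand at [P = p + 1], [Q = q + 1]; the balance condition then forces
    [a = p + q + M + n + 1]. *)
Let w k : rat := 'C(n, k)%:R * (rising (p + q + M + n).+1%:R k * (M ^_ k)%:R)
   * (rising (p + k).+1%:R (n - k) * rising (q + k).+1%:R (n - k)).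

Lemma saalschutz_nat :
  \sum_(0 <= k < n.+1) w k
  = rising (p + M).+1%:R n * rising (q + M).+1%:R n.
Proof.
rewrite -!addSn !natrD -(@pfaff_saalschutz _ (p + q + M + n).+1%:R).
  by apply: eq_bigr => k _; rewrite /w -!addSn -!natrD.
by rewrite -natr1 !natrD -!natr1 -!natrD; ring.
Qed.

Lemma deriv_saalschutz_nat :
  \sum_(0 <= k < n.+1)
     w k * (harmonic (q + n) - harmonic (q + k)
            - (harmonic (p + n) - harmonic (p + k)))
  = rising (p + M).+1%:R n * rising (q + M).+1%:R n
    * (harmonic (q + M + n) - harmonic (q + M)
       - (harmonic (p + M + n) - harmonic (p + M))).
Proof.
pose P c e : {poly rat} := c.+1%:R%:P + e *: 'X.
have PD c e k : P c e + k%:R = P (c + k)%N e.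
  by rewrite /P -addSn natrD polyCD (polyC_natr _ k) addrAC.
have derivP i j k :
  (rising (P i (-1)) k * rising (P j 1) k)^`().[0]
  = rising i.+1%:R k * rising j.+1%:R k
    * (harmonic (j + k) - harmonic j - (harmonic (i + k) - harmonic i)).
  by rewrite derivM hornerD !hornerM !horner_deriv_rising !horner_rising; ring.
have := @pfaff_saalschutz _ (p + q + M + n).+1%:R (P p (-1)) (P q 1) n M.
rewrite !PD => saal.
(* The right-hand side is recognised as a derivative at 0, so [saal] turns it into that of the sum.
   The balance condition holds because the slopes -1 and 1 cancel in [P + Q]. *)
rewrite -derivP -saal; last first.
  by rewrite /P !polyC_natr scale1r scaleN1r -!natr1 !natrD; ring.
rewrite raddf_sum horner_sum; apply: eq_big_nat => k /andP[_ le_kn].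
rewrite !PD.
have -> : rising (p + q + M + n).+1%:R k
   = (rising (p + q + M + n).+1%:R k)%:P :> {poly rat}.
  by rewrite /rising rmorph_prod; apply: eq_bigr => i _; rewrite rmorphD !rmorph_nat.
rewrite -!polyC_natr -!polyCM /= derivM derivC mul0r add0r hornerM hornerC derivP.
rewrite /w -!addnA !subnKC //; ring.
Qed.

Lemma harmonic_saalschutz :
  \sum_(0 <= k < n.+1)
     ('C(n, k)%:R * 'C(p + q + M + n + k, k)%:R * 'C(M, k)%:R
      / ('C(p + k, k)%:R * 'C(q + k, k)%:R))
     * (harmonic (p + k) - harmonic (q + k))
  = ('C(q + M + n, n)%:R * 'C(p + M + n, n)%:R
     / ('C(p + n, n)%:R * 'C(q + n, n)%:R))
    * (harmonic (p + M) - harmonic (p + M + n)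
       + harmonic (q + M + n) - harmonic (q + M)
       + harmonic (p + n) - harmonic (q + n)).
Proof.
have f_neq0 k : k`!%:R != 0 :> rat by rewrite Num.Theory.pnatr_eq0 -lt0n fact_gt0.
have binE c k : 'C(c + k, k)%:R = (c + k)`!%:R / (c`!%:R * k`!%:R) :> rat.
  rewrite -(@bin_fact (c + k) k) ?leq_addl // addnK mulnC [in RHS]natrM.
  by rewrite [(k`! * _)%N]mulnC natrM mulrC mulKf // mulf_neq0.
(* Clearing denominators turns [p! / (p + k)!] into [(p + n)! / (p + k)!], and likewise for [q]; [K]
   undoes this. *)
pose K : rat := p`!%:R * q`!%:R / ((p + n)`!%:R * (q + n)`!%:R).
transitivity (K * \sum_(0 <= k < n.+1) w k * (harmonic (p + k) - harmonic (q + k))).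
  rewrite mulr_sumr; apply: eq_big_nat => k /andP[_ le_kn].
  rewrite mulrA; congr (_ * _).
  have -> : 'C(M, k)%:R = (M ^_ k)%:R / k`!%:R :> rat.
    by rewrite -bin_ffact natrM mulfK.
  rewrite /K /w !binE !rising_natE -!addnA !subnKC // !addnA.
  by field; rewrite !f_neq0.
(* The weights from differentiation exceed the wanted ones by a constant in [k], which
   [saalschutz_nat] sums. *)
have sum_shift :
  \sum_(0 <= k < n.+1) w k * (harmonic (p + k) - harmonic (q + k))
  = \sum_(0 <= k < n.+1)
       w k * (harmonic (q + n) - harmonic (q + k)
              - (harmonic (p + n) - harmonic (p + k)))
    + (\sum_(0 <= k < n.+1) w k) * (harmonic (p + n) - harmonic (q + n)).
  by rewrite mulr_suml -big_split; apply: eq_bigr => k _ /=; ring.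
rewrite sum_shift deriv_saalschutz_nat saalschutz_nat /K !binE !rising_natE.
by field; rewrite !f_neq0.
Qed.

End HarmonicSaalschutz.

Theorem theorem4 (n lam mu nu : nat) (hlam : (1 + mu + nu < lam)%N) :
  \sum_(0 <= k < n.+1)
     ('C(n, k)%:R * 'C(lam * n + k, k)%:R * 'C(mu * n + n, k)%:R
      / ('C(nu * n + k, k)%:R * 'C((lam - mu - nu - 2) * n + k, k)%:R))
     * (harmonic (nu * n + k) - harmonic ((lam - mu - nu - 2) * n + k))
  = ('C((lam - nu) * n, n)%:R * 'C((mu + nu + 2) * n, n)%:R
     / ('C(nu * n + n, n)%:R * 'C((lam - mu - nu - 1) * n, n)%:R))
    * (harmonic ((mu + nu + 1) * n) - harmonic ((mu + nu + 2) * n)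
       + harmonic ((lam - nu) * n) - harmonic ((lam - nu - 1) * n)
       + harmonic (nu * n + n) - harmonic ((lam - mu - nu - 1) * n)).
Proof.
(* This makes all truncated subtractions exact; then [q = l * n], and [lam * n] becomes
   [p + q + M + n]. *)
have [l ->] : exists l, lam = (mu + nu + 2 + l)%N.
  by exists (lam - (mu + nu + 2))%N; lia.
have -> : (mu + nu + 2 + l - mu - nu - 2 = l)%N by lia.
have -> : ((mu + nu + 2 + l - nu) * n = l * n + (mu * n + n) + n)%N by nia.
have -> : ((mu + nu + 2 + l - nu - 1) * n = l * n + (mu * n + n))%N by nia.
have -> : ((mu + nu + 2 + l - mu - nu - 1) * n = l * n + n)%N by nia.
have -> : ((mu + nu + 2) * n = nu * n + (mu * n + n) + n)%N by lia.
have -> : ((mu + nu + 1) * n = nu * n + (mu * n + n))%N by lia.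
have -> : ((mu + nu + 2 + l) * n = nu * n + l * n + (mu * n + n) + n)%N by lia.
exact: harmonic_saalschutz.
Qed.
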